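(* For every positive integer $k$ there exist graphs $H_k, H'_k, H''_k$ such that (i) $\operatorname{box}_\ell(H_k)\ge k$; (ii) $\operatorname{box}_\ell(H'_k)=2$ and $\overline{\operatorname{box}}(H'_k)\ge k$; (iii) $\overline{\operatorname{box}}(H''_k)=1$ and $\operatorname{box}(H''_k)=k$.
   Context: All graphs are finite and simple; $H^c$ denotes the complement of $H$. An interval graph is an intersection graph of intervals on the real line; a co-interval graph is the complement of an interval graph. $\mathcal{C}$ is the class of all co-interval graphs and $\overline{\mathcal{C}}$ is the class of all graphs that are vertex-disjoint unions of co-interval graphs. A graph homomorphism $\varphi: G\to H$ is a map $V(G)\to V(H)$ with $uv\in E(G)\Rightarrow\varphi(u)\varphi(v)\in E(H)$. For a graph class $\mathcal{G}$, a graph $H$ and a positive integer $t$, a $t$-global $\mathcal{G}$-cover of $H$ is an edge-surjective homomorphism $\varphi: G_1\sqcup\cdots\sqcup G_t\to H$ (vertex-disjoint union) with each $G_i\in\mathcal{G}$; it is injective if its restriction to each $G_i$ is injective, and $s$-local if $|\varphi^{-1}(v)|\le s$ for all $v\in V(H)$. The global covering number $c_g^{\mathcal{G}}(H)$ is the minimum $t$ such that a $t$-global injective $\mathcal{G}$-cover of $H$ exists; the local covering number $c_\ell^{\mathcal{G}}(H)$ is the minimum $s$ such that an $s$-local injective $\mathcal{G}$-cover of $H$ exists (any $t$). Define the boxicity $\operatorname{box}(H):=c_g^{\mathcal{C}}(H^c)$ (equivalently, the least $d$ such that $H$ is the intersection graph of axis-aligned boxes in $\mathbb{R}^d$), the local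 boxicity $\operatorname{box}_\ell(H):=c_\ell^{\mathcal{C}}(H^c)$, and the union boxicity $\overline{\operatorname{box}}(H):=c_g^{\overline{\mathcal{C}}}(H^c)$. *)

(* Defs.v *)
From mathcomp Require Import all_boot all_order all_algebra.
From mathcomp Require Import boolp classical_sets reals.

Set Implicit Arguments.
Unset Strict Implicit.
Unset Printing Implicit Defensive.

Import Order.TTheory GRing.Theory Num.Theory.

Record sgraph := SGraph {
  vertex :> finType;
  adj : rel vertex;
  adj_sym : symmetric adj;
  adj_irr : irreflexive adj }.

Section Complement.
Variable G : sgraph.

Definition compl_adj : rel G := fun u v => (u != v) && ~~ adj u v.

Lemma compl_adj_sym : symmetric compl_adj.
Proof. by move=> u v; rewrite /compl_adj eq_sym adj_sym. Qed.

Lemma compl_adj_irr : irreflexive compl_adj.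
Proof. by move=> u; rewrite /compl_adj eqxx. Qed.

Definition compl : sgraph := SGraph compl_adj_sym compl_adj_irr.

End Complement.

Section DisjointUnion.
Variables (I : finType) (G : I -> sgraph).

Definition dunion_vertex : finType := {i : I & vertex (G i)}.

Definition dunion_adj : rel dunion_vertex :=
  fun u v => (tag u == tag v) && adj (tagged u) (tagged_as u v).

Lemma dunion_adj_sym : symmetric dunion_adj.
Proof.
move=> [i x] [j y]; rewrite /dunion_adj /= eq_sym; case: eqP => //= eij.
by case: _ / eij x => x; rewrite !tagged_asE adj_sym.
Qed.

Lemma dunion_adj_irr : irreflexive dunion_adj.
Proof. by move=> [i x]; rewrite /dunion_adj /= eqxx tagged_asE adj_irr. Qed.

Definition dunion : sgraph := SGraph dunion_adj_sym dunion_adj_irr.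

End DisjointUnion.

Definition homomorphism (G H : sgraph) (f : G -> H) : Prop :=
  forall u v : G, adj u v -> adj (f u) (f v).

Definition edge_surjective (G H : sgraph) (f : G -> H) : Prop :=
  forall u v : H, adj u v -> exists x y : G, [/\ adj x y, f x = u & f y = v].

Definition isomorphic (G H : sgraph) : Prop :=
  exists2 f : G -> H, bijective f & forall u v : G, adj (f u) (f v) = adj u v.

(* Intervals are nonempty but may be open or closed, bounded or not. *)
Definition interval_graph (R : realType) (G : sgraph) : Prop :=
  exists J : G -> interval R,
    (forall v : G, exists x : R, x \in J v) /\
    (forall u v : G, u != v ->
       (adj u v <-> exists x : R, x \in J u /\ x \in J v)).

Definition cointerval_graph (R : realType) (G : sgraph) : Prop :=
  interval_graph R (compl G).

Definition union_cointerval_graph (R : realType) (G : sgraph) : Prop :=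
  exists (n : nat) (F : 'I_n -> sgraph),
    (forall i, cointerval_graph R (F i)) /\ isomorphic G (dunion F).

Definition global_cover (K : sgraph -> Prop) (H : sgraph) (t : nat)
    (G : 'I_t -> sgraph) (f : dunion G -> H) : Prop :=
  [/\ 0 < t, forall i, K (G i), homomorphism f & edge_surjective f].

Definition injective_cover (H : sgraph) (t : nat)
    (G : 'I_t -> sgraph) (f : dunion G -> H) : Prop :=
  forall i : 'I_t, injective (fun x : G i => f (Tagged (fun j => vertex (G j)) x)).

Definition local_cover (H : sgraph) (t : nat)
    (G : 'I_t -> sgraph) (f : dunion G -> H) (s : nat) : Prop :=
  forall v : H, #|[pred x : dunion G | f x == v]| <= s.

Definition has_global_cover (K : sgraph -> Prop) (H : sgraph) (t : nat) : Prop :=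
  exists (G : 'I_t -> sgraph) (f : dunion G -> H),
    global_cover K f /\ injective_cover f.

Definition has_local_cover (K : sgraph -> Prop) (H : sgraph) (s : nat) : Prop :=
  exists (t : nat) (G : 'I_t -> sgraph) (f : dunion G -> H),
    [/\ global_cover K f, injective_cover f & local_cover f s].

(* The junk value when P is empty is 0; by has_global_cover_ex and
   has_local_cover_ex below it is never taken by box, box_local, box_union. *)
Definition minimum (P : nat -> Prop) : nat :=
  xget 0 [set n | P n /\ forall m, P m -> n <= m]%classic.

Definition global_covering_number (K : sgraph -> Prop) (H : sgraph) : nat :=
  minimum (has_global_cover K H).

Definition local_covering_number (K : sgraph -> Prop) (H : sgraph) : nat :=
  minimum (has_local_cover K H).

Definition box (R : realType) (H : sgraph) : nat :=
  global_covering_number (cointerval_graph R) (compl H).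

Definition box_local (R : realType) (H : sgraph) : nat :=
  local_covering_number (cointerval_graph R) (compl H).

Definition box_union (R : realType) (H : sgraph) : nat :=
  global_covering_number (union_cointerval_graph R) (compl H).

Lemma minimumP (P : nat -> Prop) :
  (exists n, P n) -> P (minimum P) /\ forall m, P m -> minimum P <= m.
Proof.
move=> [n Pn]; rewrite /minimum.
case: xgetP => [m _ []//|none]; exfalso.
have exP : exists m, `[< P m >] by exists n; apply/asboolP.
case: (ex_minnP exP) => m /asboolP Pm mmin.
by apply: (none m); split=> // q Pq; apply: mmin; apply/asboolP.
Qed.

Section OneEdge.
Variables (H : sgraph) (q : option {p : H * H | adj p.1 p.2}).

Definition one_edge_adj : rel H := fun u v =>
  if q is Some p then ((u, v) == val p) || ((v, u) == val p) else false.

Lemma one_edge_adj_sym : symmetric one_edge_adj.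
Proof. by move=> u v; rewrite /one_edge_adj; case: q => // p; rewrite orbC. Qed.

Lemma one_edge_adjW u v : one_edge_adj u v -> adj u v.
Proof.
rewrite /one_edge_adj; case: q => // -[[a b] /= ab] /orP[] /eqP[-> ->] //.
by rewrite adj_sym.
Qed.

Lemma one_edge_adj_irr : irreflexive one_edge_adj.
Proof. by move=> u; apply/negP => /one_edge_adjW; rewrite adj_irr. Qed.

Definition one_edge : sgraph := SGraph one_edge_adj_sym one_edge_adj_irr.

Lemma cointerval_one_edge (R : realType) : cointerval_graph R one_edge.
Proof.
pose J (v : H) : interval R := (if q is Some p then
    if v == (val p).1 then `[0, 0] else if v == (val p).2 then `[1, 1]
    else `[0, 1] else `[0, 1])%R.
exists J; split => [v|u v uv].
  rewrite /J; case: q => [[[a b] ab]|] /=; last by exists 0%R; rewrite in_itv /= lexx ler01.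
  case: eqP => _; first by exists 0%R; rewrite in_itv /= lexx.
  by case: eqP => _; [exists 1%R|exists 0%R]; rewrite in_itv /= lexx ?ler01.
rewrite /J /= /compl_adj /= /one_edge_adj uv /=; case: q => [[[a b] /= ab]|]; last first.
  by split=> // _; exists 0%R; rewrite in_itv /= lexx ler01.
have nab : a != b by apply: contraTneq ab => ->; rewrite adj_irr.
rewrite -!pair_eqE /=.
have [ua|ua] := eqVneq u a; have [va|va] := eqVneq v a.
- by rewrite ua va eqxx in uv.
- subst u; rewrite (negbTE nab) /= orbF; have [vb|vb] /= := eqVneq v b.
    split=> // -[x]; rewrite !in_itv /= -!eq_le => -[/eqP <- /eqP].
    by move/eqP; rewrite oner_eq0.
  by split=> // _; exists 0%R; rewrite !in_itv /= lexx ler01.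
- subst v; rewrite /=; have [ub|ub] /= := eqVneq u b.
    split=> // -[x]; rewrite !in_itv /= -!eq_le => -[/eqP <- /eqP].
    by move/esym/eqP; rewrite oner_eq0.
  by split=> // _; exists 0%R; rewrite !in_itv /= lexx ler01.
- split=> // _; exists 1%R.
  by case: eqP => _; case: eqP => _; rewrite !in_itv /= lexx ?ler01.
Qed.

End OneEdge.

Lemma union_cointerval_cointerval (R : realType) (G : sgraph) :
  cointerval_graph R G -> union_cointerval_graph R G.
Proof.
move=> cG; exists 1, (fun=> G); split=> //.
exists (fun x : G => existT (fun _ => vertex G) ord0 x : dunion (fun _ : 'I_1 => G)).
  exists (fun u : dunion (fun _ : 'I_1 => G) => tagged u) => // -[i x] /=.
  by rewrite [i]ord1.
by move=> u v /=; rewrite /dunion_adj /= ?eqxx tagged_asE.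
Qed.

Lemma has_local_cover_ex (R : realType) (H : sgraph) :
  exists s, has_local_cover (cointerval_graph R) H s.
Proof.
pose Q : finType := option {p : H * H | adj p.1 p.2}.
pose G (i : 'I_#|Q|) := one_edge (enum_val i : Q).
pose f (u : dunion G) : H := tagged u.
exists #|dunion G|, #|Q|, G, f; split; last by move=> v; apply: max_card.
- split.
  + by apply/card_gt0P; exists None.
  + by move=> i; apply: cointerval_one_edge.
  + move=> [i x] [j y] /andP[/= /eqP eij]; case: _ / eij y => y.
    by rewrite tagged_asE => /one_edge_adjW.
  + move=> u v uv; pose q : Q := Some (exist (fun p : H * H => adj p.1 p.2) (u, v) uv).
    pose i := enum_rank q.
    exists (Tagged (fun j => vertex (G j)) (u : G i)).
    exists (Tagged (fun j => vertex (G j)) (v : G i)).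
    split=> //=; rewrite /dunion_adj /= eqxx tagged_asE /= /one_edge_adj enum_rankK /=.
    by rewrite eqxx.
- by move=> i x y.
Qed.

Lemma has_global_cover_ex (R : realType) (H : sgraph) :
  (exists t, has_global_cover (cointerval_graph R) H t) /\
  (exists t, has_global_cover (union_cointerval_graph R) H t).
Proof.
have [s [t [G [f [[t0 GK fh fs] fi _]]]]] := has_local_cover_ex R H.
split; exists t, G, f; split=> //; split=> // i.
exact: union_cointerval_cointerval.
Qed.

(* Main.v *)
(** Disjointness of intervals is an interval order, so co-interval graphs contain
no induced 2K2, and in a C4-free co-interval graph the vertex with the leftmost
right end and the one with the rightmost left end meet every edge.

(i) The point-line incidence graph of the affine plane over F_p is C4-free, so
a part of a cover with m vertices carries at most O(m) edges, while the graph
has p times as many edges as points; hence an s-local cover has s >= p / 8.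

(ii) The shift graph (pairs i < j, with ij joined to jl) is covered by the
bicliques "all ij versus all jl", one for each j, and the vertex ij lies in two
of them. Given a cover by few unions of co-interval graphs, colour the triple
i < j < l by a part containing the edge ij - jl. On sufficiently many points
some six of them carry a monochromatic path 12, 23, 34, 45, 56. It lies in one
component of one part, where the edges 12 - 23 and 45 - 56 induce a 2K2.

(iii) The perfect matching k K2 is itself a union of co-interval graphs, but a
co-interval subgraph contains at most one of its edges. *)

Require Import Defs.
From mathcomp Require Import all_boot all_order all_algebra.
From mathcomp Require Import boolp classical_sets reals.
From mathcomp Require Import zify ring.

Set Implicit Arguments.
Unset Strict Implicit.
Unset Printing Implicit Defensive.

Import Order.TTheory GRing.Theory Num.Theory.

(** * Double complements and minima *)

Lemma sgraph_eq (V : finType) (a a' : rel V) asym airr asym' airr' :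
  (forall u v, a u v = a' u v) -> @SGraph V a asym airr = @SGraph V a' asym' airr'.
Proof.
move=> eqa; have {eqa} E : a = a' by apply/funext => u; apply/funext => v.
by subst a'; congr SGraph; apply: Prop_irrelevance.
Qed.

(** Being an equality rather than an isomorphism, this lets a covering number of [compl (compl H)]
    be rewritten to one of [H]. *)
Lemma complK (G : sgraph) : compl (compl G) = G.
Proof.
case: G => V a asym airr; apply: sgraph_eq => u v.
rewrite /compl_adj /= /compl_adj /=.
by have [->|_] /= := eqVneq u v; rewrite ?airr ?negbK.
Qed.

Lemma minimum_ge (P : nat -> Prop) (k : nat) :
  (exists n, P n) -> (forall m, P m -> k <= m) -> k <= minimum P.
Proof. by move=> /minimumP[Pm _]; apply. Qed.

Lemma minimum_eq (P : nat -> Prop) (k : nat) :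
  P k -> (forall m, P m -> k <= m) -> minimum P = k.
Proof.
move=> Pk Pge; have exP : exists n, P n by exists k.
apply/eqP; rewrite eqn_leq minimum_ge // andbT.
by have [_] := minimumP exP; apply.
Qed.

(** * Interval orders and co-interval graphs *)

Section IntervalOrder.
Variables (R : realType) (G : sgraph).

Lemma itv_between (J : interval R) (x y z : R) :
  x \in J -> y \in J -> (x <= z <= y)%R -> z \in J.
Proof.
case: J => l r; rewrite !itv_boundlr => /andP[lx _] /andP[_ yr] /andP[xz zy].
apply/andP; split; first by apply: le_trans lx _; rewrite bnd_simp.
by apply: le_trans yr; rewrite bnd_simp.
Qed.

(** [L u v] holds when the interval of [u] lies wholly to the left of that of [v]. If [L a d] fails,
    some [y] in [J d] is at most some [x] in [J a]; then [J c] lies before [y] and [J b] after [x],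
    which gives [L c b]. *)
Lemma cointerval_order : cointerval_graph R G ->
  exists L : rel G, (forall u v, adj u v = L u v || L v u) /\
    (forall a b c d, L a b -> L c d -> L a d || L c b).
Proof.
move=> [J [Jne JE]].
pose L u v := `[< forall x y, x \in J u -> y \in J v -> (x < y)%R >].
have Lirr u : L u u = false.
  apply/negP => /asboolP Lu; have [x xu] := Jne u.
  by have := Lu x x xu xu; rewrite ltxx.
have Ldisj u v x : L u v -> x \in J u -> x \in J v -> False.
  by move=> /asboolP uv xu xv; have := uv _ _ xu xv; rewrite ltxx.
(* A single comparison orders two disjoint intervals entirely, since otherwise convexity produces a
   common point. *)
have disjL u v x0 y0 : (forall x, x \in J u -> x \in J v -> False) ->
    x0 \in J u -> y0 \in J v -> (x0 < y0)%R -> L u v.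
  move=> dis x0u y0v lt0; apply/asboolP => x y xu yv; rewrite ltNge; apply/negP => yx.
  have [xy|yx0] := leP x0 y.
    by apply: (dis y) => //; apply: (itv_between x0u xu); rewrite xy.
  by apply: (dis x0) => //; apply: (itv_between yv y0v); rewrite !ltW.
exists L; split=> [u v|a b c d /asboolP ab /asboolP cd].
  have [<-|uv] := eqVneq u v; first by rewrite adj_irr Lirr.
  have cuv : compl_adj u v = ~~ adj u v by rewrite /compl_adj uv.
  have := JE u v uv; rewrite /= cuv => JEuv.
  apply/idP/orP => [auv|Luv].
    have dis x : x \in J u -> x \in J v -> False.
      move=> xu xv; have /JEuv : exists x, x \in J u /\ x \in J v by exists x.
      by rewrite auv.
    have [x0 x0u] := Jne u; have [y0 y0v] := Jne v.
    case: (ltgtP x0 y0) => [lt|gt|eq0].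
    - by left; apply: disjL lt.
    - by right; apply: disjL gt => // x ? ?; apply: (dis x).
    - by exfalso; apply: (dis x0) => //; rewrite eq0.
  apply: contraT => /JEuv[x [xu xv]].
  by case: Luv => [l|l]; [case: (Ldisj _ _ _ l xu xv)|case: (Ldisj _ _ _ l xv xu)].
apply: contraT; rewrite negb_or => /andP[/asboolPn nad /asboolPn ncb].
exfalso; apply: nad => x y xa yd; rewrite ltNge; apply/negP => yx.
apply: ncb => z w zc wb.
by apply: lt_trans (cd _ _ zc yd) _; apply: le_lt_trans yx (ab _ _ xa wb).
Qed.

Lemma cointerval_2K2_free (x y z w : G) : cointerval_graph R G ->
  adj x y -> adj z w -> [|| adj x z, adj x w, adj y z | adj y w].
Proof.
move=> /cointerval_order[L [LE Lio]].
rewrite !LE => /orP[xy|yx] /orP[zw|wz].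
- by case/orP: (Lio _ _ _ _ xy zw) => ->; rewrite ?orbT.
- by case/orP: (Lio _ _ _ _ xy wz) => ->; rewrite ?orbT.
- by case/orP: (Lio _ _ _ _ yx zw) => ->; rewrite ?orbT.
- by case/orP: (Lio _ _ _ _ yx wz) => ->; rewrite ?orbT.
Qed.

Lemma cointerval_C4_free_cover :
  cointerval_graph R G ->
  (forall a b c d : G, adj a b -> adj b c -> adj c d -> adj d a ->
     a = c \/ b = d) ->
  forall x0 : G, exists a b : G, forall u v : G,
    adj u v -> [|| u == a, u == b, v == a | v == b].
Proof.
move=> /cointerval_order[L [LE Lio]] C4 x0.
pose up u := [set v | L u v]; pose down v := [set u | L u v].
have [a _ amax] := arg_maxnP (fun u => #|up u|) (erefl (predT x0)).
have [b _ bmax] := arg_maxnP (fun v => #|down v|) (erefl (predT x0)).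
(* Up-sets of an interval order form a chain, so the largest contains all of them. *)
have aup u v : L u v -> L a v.
  move=> uv; apply: contraT => nav.
  have sub : up a \subset up u.
    apply/fintype.subsetP => w; rewrite !inE => aw.
    by case/orP: (Lio _ _ _ _ aw uv) => //; rewrite (negbTE nav).
  have : up a \proper up u.
    by apply/properP; split=> //; exists v; rewrite !inE.
  by move/proper_card; rewrite ltnNge => /negP; case; apply: amax.
have bdown u v : L u v -> L u b.
  move=> uv; apply: contraT => nub.
  have sub : down b \subset down v.
    apply/fintype.subsetP => w; rewrite !inE => wb.
    by case/orP: (Lio _ _ _ _ uv wb) => //; rewrite (negbTE nub).
  have : down b \proper down v.
    by apply/properP; split=> //; exists u; rewrite !inE.
  by move/proper_card; rewrite ltnNge => /negP; case; apply: bmax.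
exists a, b => u v.
have main s t : L s t -> s = a \/ t = b.
  move=> st; have sb := bdown _ _ st; have at_ := aup _ _ st.
  have ab := aup _ _ sb.
  (* Every edge [L s t] closes up to the 4-walk [s], [t], [a], [b], which must be degenerate. *)
  apply: (C4 s t a b); rewrite LE ?st ?at_ ?ab ?sb ?orbT //.
rewrite LE => /orP[] /main[->|->]; rewrite eqxx ?orbT //.
Qed.

End IntervalOrder.

Lemma biclique_cointerval (R : realType) (G : sgraph) (A B : pred G) :
  (forall u v, adj u v = A u && B v || A v && B u) -> cointerval_graph R G.
Proof.
move=> adjE.
have AB u : A u -> B u = false.
  by move=> Au; have := adj_irr u; rewrite adjE Au /= orbb.
(* The two sides become two distinct points; a vertex outside both gets an interval meeting all
   others, hence is isolated in [G]. *)
pose J (v : G) : interval R :=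
  (if A v then `[0, 0] else if B v then `[1, 1] else `[0, 1])%R.
have J0 v : B v = false -> (0%R : R) \in J v.
  by move=> Bv; rewrite /J Bv; case: (A v); rewrite in_itv /= lexx ?ler01.
have J1 v : A v = false -> (1%R : R) \in J v.
  by move=> Av; rewrite /J Av; case: (B v); rewrite in_itv /= lexx ?ler01.
have JAB (u v : G) (x : R) : A u -> B v -> x \in J u -> x \in J v -> False.
  move=> Au Bv; have Av : A v = false by apply/negP => /AB; rewrite Bv.
  rewrite /J Au Av Bv !in_itv /= -!eq_le => /eqP <- /eqP/eqP.
  by rewrite oner_eq0.
exists J; split=> [v|u v uv].
  case Av: (A v); last by exists 1%R; apply: J1.
  by exists 0%R; apply: J0; apply: AB.
rewrite /= /compl_adj uv adjE /=; split=> [|[x [xu xv]]].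
  case Au: (A u); case Av: (A v) => /=.
  - by exists 0%R; rewrite !J0 // AB.
  - by rewrite orbF => /negbTE Bv; exists 0%R; rewrite !J0 // AB.
  - by move=> /negbTE Bu; exists 0%R; rewrite !J0 // AB.
  - by exists 1%R; rewrite !J1.
rewrite negb_or; apply/andP; split; apply/andP => -[a b].
  exact: JAB xu xv.
exact: JAB xv xu.
Qed.

(** * Edges and vertices of a cover *)

Local Notation in_part G := (Tagged (fun j => vertex (G j))) (only parsing).

Section CoverEdges.
Variables (H : sgraph) (t : nat) (G : 'I_t -> sgraph) (f : dunion G -> H).

Lemma dunion_adj_Tagged (i : 'I_t) (x y : G i) :
  adj (in_part G x : dunion G)
      (in_part G y) = adj x y.
Proof. by rewrite /= /dunion_adj /= eqxx tagged_asE. Qed.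

Lemma dunion_adjP (u v : dunion G) : adj u v ->
  exists (i : 'I_t) (x y : G i),
    [/\ adj x y, u = in_part G x
      & v = in_part G y].
Proof.
case: u v => [i x] [j y] /andP[/= /eqP eij]; case: _ / eij y => y.
by rewrite tagged_asE; exists i, x, y.
Qed.

Lemma card_local_cover (s : nat) : local_cover f s -> #|dunion G| <= s * #|H|.
Proof.
move=> loc; rewrite -sum1_card (partition_big f predT) //=.
rewrite -sum1_card big_distrr /= leq_sum // => v _.
by rewrite muln1 sum1_card; apply: loc.
Qed.

End CoverEdges.

(** * Local boxicity is unbounded *)

(* Each vertex z of the cover, together with one of the two hubs of its part and
   an orientation, accounts for one ordered edge. *)
Lemma C4_free_local_cover (R : realType) (H : sgraph) (s : nat) :
  (forall a b c d : H, adj a b -> adj b c -> adj c d -> adj d a ->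
     a = c \/ b = d) ->
  has_local_cover (cointerval_graph R) H s ->
  #|[set e : H * H | adj e.1 e.2]| <= s * #|H| * 4.
Proof.
move=> C4 [t [G [f [[_ coG fh fs] fi loc]]]].
have [->|[e0 _]] := set_0Vmem [set e : H * H | adj e.1 e.2]; first by rewrite cards0.
have hubs (i : 'I_t) : exists w : bool -> H, forall x y : G i, adj x y ->
    exists b, f (in_part G x) = w b \/ f (in_part G y) = w b.
  have [[x0]|none] := pselect (inhabited (G i)); last first.
    (* An empty part has no edges, so any vertex of [H] will do as its hubs. *)
    by exists (fun=> e0.1) => x; case: none.
  have C4i (a b c d : G i) : adj a b -> adj b c -> adj c d -> adj d a -> a = c \/ b = d.
    rewrite -!dunion_adj_Tagged => /fh ab /fh bc /fh cd /fh da.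
    by have [/fi|/fi] := C4 _ _ _ _ ab bc cd da; [left|right].
  have [a [b ab]] := cointerval_C4_free_cover (coG i) C4i x0.
  exists (fun c => if c then f (in_part G a) else f (in_part G b)) => x y /ab.
  by case/or4P => /eqP->; [exists true|exists false|exists true|exists false]; auto.
have [w wP] := choice hubs.
pose g (q : dunion G * (bool * bool)) : H * H :=
  let h := w (tag q.1) q.2.1 in if q.2.2 then (h, f q.1) else (f q.1, h).
have sub : [set e : H * H | adj e.1 e.2] \subset [set g q | q in predT].
  apply/fintype.subsetP => -[u v]; rewrite inE /= => /fs[x' [y' [xy' <- <-]]].
  have [i [x [y [xy -> ->]]]] := dunion_adjP xy'.
  have [b [E|E]] := wP i x y xy; rewrite E; apply/imsetP.
    by exists (in_part G y, (b, true)).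
  by exists (in_part G x, (b, false)).
apply: leq_trans (subset_leq_card sub) _.
apply: leq_trans (leq_imset_card _ _) _.
by rewrite !card_prod !card_bool leq_mul2r /= (card_local_cover loc).
Qed.

Section AffinePlane.
Variable p : nat.
Let F : finType := 'F_p.

(* [inl (x, y)] is a point and [inr (m, b)] the line Y = m X + b. *)
Definition incidence_adj : rel ((F * F) + (F * F))%type := fun u v =>
  match u, v with
  | inl P, inr l | inr l, inl P => P.2 == (l.1 * P.1 + l.2)%R :> 'F_p
  | _, _ => false
  end.

Lemma incidence_adj_sym : symmetric incidence_adj.
Proof. by case=> [P|l] [P'|l']. Qed.

Lemma incidence_adj_irr : irreflexive incidence_adj.
Proof. by case. Qed.

Definition incidence_graph : sgraph := SGraph incidence_adj_sym incidence_adj_irr.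

(** Two distinct points lie on at most one common line: subtracting the four equations gives
    [(m - m') * (x - x') = 0], so the slopes or the abscissae agree, and with them the lines or the
    points. *)
Lemma incidence_C4_free (a b c d : incidence_graph) :
  adj a b -> adj b c -> adj c d -> adj d a -> a = c \/ b = d.
Proof.
have two_points (x y x' y' m n m' n' : 'F_p) :
    (y == m * x + n -> y' == m * x' + n -> y' == m' * x' + n' ->
     y == m' * x + n' -> (x, y) = (x', y') \/ (m, n) = (m', n'))%R.
  move=> /eqP-> /eqP-> /eqP e1 /eqP e2.
  have : ((m - m') * (x - x') == 0)%R.
    have -> : ((m - m') * (x - x') = (m * x + n - (m' * x + n')) -
                (m * x' + n - (m' * x' + n')))%R by ring.
    by rewrite -e1 -e2 !subrr.
  rewrite mulf_eq0 !subr_eq0 => /orP[/eqP em|/eqP ex].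
    by right; move: e1; rewrite em => /addrI->.
  by left; rewrite ex.
case: a b c d => [[x y]|[m n]] [[x1 y1]|[m1 n1]] [[x2 y2]|[m2 n2]] [[x3 y3]|[m3 n3]] //=.
  by move=> h1 h2 h3 h4; case: (two_points _ _ _ _ _ _ _ _ h1 h2 h3 h4) => ->; [left|right].
move=> h1 h2 h3 h4; have [E|E] := two_points _ _ _ _ _ _ _ _ h1 h4 h3 h2.
  by right; rewrite E.
by left; rewrite E.
Qed.

Hypothesis p_pr : prime p.

Lemma card_incidence_graph : #|incidence_graph| = (p ^ 2).*2.
Proof. by rewrite /= card_sum card_prod card_Fp // addnn. Qed.

(** Slope, abscissa and intercept can be chosen freely and determine a flag; only the orientation
    from point to line is counted. *)
Lemma card_incidence_edges :
  p ^ 3 <= #|[set e : incidence_graph * incidence_graph | adj e.1 e.2]|.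
Proof.
pose g (q : 'F_p * 'F_p * 'F_p) : incidence_graph * incidence_graph :=
  (inl (q.1.2, (q.1.1 * q.1.2 + q.2)%R), inr (q.1.1, q.2)).
have g_inj : injective g.
  by move=> [[m x] b] [[m' x'] b'] [-> _ -> ->].
have <- : #|[set g q | q in predT]| = p ^ 3.
  by rewrite card_imset // !card_prod card_Fp // !expnS expn0 muln1 mulnA.
apply: subset_leq_card; apply/fintype.subsetP => _ /imsetP[[[m x] b] _ ->].
by rewrite inE /=.
Qed.

Lemma incidence_local_cover (R : realType) (s : nat) :
  has_local_cover (cointerval_graph R) incidence_graph s -> p <= s * 8.
Proof.
move=> /(C4_free_local_cover incidence_C4_free)/(leq_trans card_incidence_edges).
have q_gt0 : 0 < p ^ 2 by rewrite expn_gt0 prime_gt0.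
rewrite card_incidence_graph expnS => le_pq.
(* The count reads [p ^ 3 <= s * (2 * p ^ 2) * 4]; cancelling [p ^ 2] leaves the factor 8. *)
by rewrite -(leq_pmul2r q_gt0); apply: leq_trans le_pq _; lia.
Qed.

End AffinePlane.

(** * Local and union boxicity of the complement of a shift graph *)

(** Let [T b] be the set of colours of pairs ending at [b]. For [b < c] the colour of [(b, c)] lies
    in [T c], and if it also lies in [T b] there is a triple as required. Without such a triple the
    sets [T b] are distinct, so [n] is at most [2 ^ #|C|]. *)
Lemma shift_colouring (n : nat) (C : finType) (col : 'I_n -> 'I_n -> C) :
  2 ^ #|C| < n ->
  exists a b c : 'I_n, [/\ a < b, b < c & col a b = col b c].
Proof.
move=> lt_n; apply: contrapT => none.
pose T (b : 'I_n) := [set col a b | a : 'I_n & a < b].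
have T_inj : injective T.
  have lt_neq (b c : 'I_n) : b < c -> T b <> T c.
    move=> bc eqT; have : col b c \in T c by apply: imset_f; rewrite inE.
    rewrite -eqT => /imsetP[a]; rewrite inE => ab E.
    by apply: none; exists a, b, c.
  move=> b c eqT; case: (ltngtP b c) => [/lt_neq//|/lt_neq/(_ (esym eqT))//|].
  exact: val_inj.
have := leq_card T T_inj.
rewrite card_ord -cardsT -powersetT card_powerset cardsT.
by rewrite leqNgt lt_n.
Qed.

Section MonochromaticPath.
Variables (n : nat) (C : finType) (col : 'I_n -> 'I_n -> 'I_n -> C).

(** A path of [l] consecutive triples of colour [c], traced backwards from its last pair [(a, b)];
    the inequality [a < b] is left to the context. *)
Fixpoint ends_path (l : nat) (c : C) (a b : 'I_n) : bool :=
  if l is l'.+1 then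
    [exists a' : 'I_n, [&& a' < a, col a' a b == c & ends_path l' c a' a]]
  else true.

(* Colouring a pair by the set of (length, colour) of monochromatic paths ending
   there, two consecutive pairs of equal colour prolong a path beyond the cap. *)
Lemma monochromatic_path (l : nat) : 2 ^ (2 ^ (l.+1 * #|C|)) < n ->
  exists (c : C) (a b : 'I_n), a < b /\ ends_path l.+1 c a b.
Proof.
move=> lt_n.
pose S a b := [set q : 'I_l.+1 * C | ends_path q.1 q.2 a b].
have [|a [b [d [ab bd eqS]]]] := @shift_colouring n _ S.
  by rewrite -cardsT -powersetT card_powerset cardsT card_prod card_ord.
exists (col a b d), b, d; split=> //.
have step j : ends_path j (col a b d) a b -> ends_path j.+1 (col a b d) b d.
  by move=> h; apply/existsP; exists a; rewrite ab eqxx.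
(* The path prolonged to length [j.+1] ends at [(b, d)]; equality of the two colour sets carries its
   length and colour back to [(a, b)]. *)
have all_j j : j < l.+1 -> ends_path j (col a b d) a b.
  elim: j => [//|j IH] lt_j.
  have : (Ordinal lt_j, col a b d) \in S b d.
    by rewrite inE; apply: step; apply: IH; apply: ltnW.
  by rewrite -eqS inE.
by apply: step; apply: all_j.
Qed.

End MonochromaticPath.

Section ShiftGraph.
Variables (R : realType) (n : nat).

Definition shift : rel ('I_n * 'I_n) :=
  fun u v => [&& u.1 < u.2, u.2 == v.1 & v.1 < v.2].

Definition shift_adj : rel ('I_n * 'I_n) := fun u v => shift u v || shift v u.

Lemma shift_adj_sym : symmetric shift_adj.
Proof. by move=> u v; rewrite /shift_adj orbC. Qed.

Lemma shift_adj_irr : irreflexive shift_adj.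
Proof.
move=> u; rewrite /shift_adj orbb /shift; apply/and3P => -[u12 /eqP E _].
by rewrite E ltnn in u12.
Qed.

(* Pairs that are not increasing are isolated vertices. *)
Definition shift_graph : sgraph := SGraph shift_adj_sym shift_adj_irr.

(** The path keeps all five vertices in one component, where its first and last edges cannot induce
    a 2K2. *)
Lemma union_cointerval_path (G : sgraph) (x1 x2 x3 x4 x5 : G) :
  union_cointerval_graph R G ->
  adj x1 x2 -> adj x2 x3 -> adj x3 x4 -> adj x4 x5 ->
  [|| adj x1 x4, adj x1 x5, adj x2 x4 | adj x2 x5].
Proof.
move=> [m [F [coF [g _ gE]]]].
rewrite -(gE x1 x2) -(gE x2 x3) -(gE x3 x4) -(gE x4 x5).
rewrite -(gE x1 x4) -(gE x1 x5) -(gE x2 x4) -(gE x2 x5).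
case: (g x1) (g x2) (g x3) (g x4) (g x5) =>
  [i1 y1] [i2 y2] [i3 y3] [i4 y4] [i5 y5] h12 h23 h34 h45.
have /andP[/= /eqP e12 _] := h12; have /andP[/= /eqP e23 _] := h23.
have /andP[/= /eqP e34 _] := h34; have /andP[/= /eqP e45 _] := h45.
subst i2 i3 i4 i5; move: h12 h45; rewrite !dunion_adj_Tagged.
move=> h12 h45; rewrite /dunion_adj /= !eqxx !tagged_asE /=.
exact: cointerval_2K2_free (coF _) h12 h45.
Qed.

Definition lifts (G : sgraph) (f : G -> shift_graph) (a b c : 'I_n) : Prop :=
  exists x y : G, [/\ adj x y, f x = (a, b) & f y = (b, c)].

(** Injectivity glues the four lifted edges into one path. A chord between its first and last edges
    would map to an edge of the shift graph joining one of 12, 23 to one of 45, 56, and there is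
    none. *)
Lemma no_lifted_path (G : sgraph) (f : G -> shift_graph)
    (a1 a2 a3 a4 a5 a6 : 'I_n) :
  union_cointerval_graph R G -> homomorphism f -> injective f ->
  [/\ a1 < a2, a2 < a3, a3 < a4, a4 < a5 & a5 < a6] ->
  lifts f a1 a2 a3 -> lifts f a2 a3 a4 -> lifts f a3 a4 a5 -> lifts f a4 a5 a6 ->
  False.
Proof.
move=> uG fh fi [l12 l23 l34 l45 l56].
move=> [x1 [x2 [h12 f1 f2]]] [x2' [x3 [h23 f2' f3]]].
move=> [x3' [x4 [h34 f3' f4]]] [x4' [x5 [h45 f4' f5]]].
have e2 : x2' = x2 by apply: fi; rewrite f2 f2'.
have e3 : x3' = x3 by apply: fi; rewrite f3 f3'.
have e4 : x4' = x4 by apply: fi; rewrite f4 f4'.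
subst x2' x3' x4'.
have := union_cointerval_path uG h12 h23 h34 h45.
by case/or4P => /fh; rewrite ?f1 ?f2 ?f4 ?f5 /= /shift_adj /shift -!val_eqE /=; lia.
Qed.

Lemma shift_graph_union_cover (t : nat) : 2 ^ (2 ^ (4 * t)) < n ->
  ~ has_global_cover (union_cointerval_graph R) shift_graph t.
Proof.
move=> lt_n [G [f [[t_gt0 uG fh fs] fi]]].
pose fp (i : 'I_t) (x : G i) := f (in_part G x).
have ex_col (q : 'I_n * 'I_n * 'I_n) : exists i : 'I_t,
    q.1.1 < q.1.2 -> q.1.2 < q.2 -> lifts (fp i) q.1.1 q.1.2 q.2.
  case: q => [[a b] c] /=.
  have [/andP[ab bc]|no] := boolP ((a < b) && (b < c)); last first.
    (* A triple that is not increasing gets an arbitrary part as its colour. *)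
    by exists (Ordinal t_gt0) => ab bc; rewrite ab bc in no.
  have abc : adj ((a, b) : shift_graph) (b, c).
    by rewrite /= /shift_adj /shift /= ab bc eqxx.
  have [x' [y' [xy' fx fy]]] := fs _ _ abc.
  have [i [x [y [xy ex ey]]]] := dunion_adjP xy'.
  by exists i => _ _; exists x, y; split; rewrite /fp -?ex -?ey.
have [col colP] := choice ex_col.
(* The value 3 yields a path of four triples, thus six points, and accounts for the factor 4 in the
   bound on [n]. *)
have [|i [a5 [a6 [l56 path]]]] :=
  @monochromatic_path n _ (fun a b c => col (a, b, c)) 3.
  by rewrite card_ord.
move: path => /existsP[a4 /and3P[l45 /eqP c4]] /existsP[a3 /and3P[l34 /eqP c3]].
move=> /existsP[a2 /and3P[l23 /eqP c2]] /existsP[a1 /and3P[l12 /eqP c1 _]].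
have fpP (a b c : 'I_n) : a < b -> b < c -> col (a, b, c) = i -> lifts (fp i) a b c.
  by move=> ab bc <-; apply: (colP (a, b, c)).
apply: (@no_lifted_path (G i) (fp i) a1 a2 a3 a4 a5 a6) => //; try exact: fpP.
by move=> x y xy; apply: fh; rewrite dunion_adj_Tagged.
Qed.

(** A 1-local cover is injective on the whole disjoint union, which is then a single union of
    co-interval graphs carrying the forbidden path on the first six points. *)
Lemma shift_graph_local_cover_ge2 (s : nat) : 5 < n ->
  has_local_cover (cointerval_graph R) shift_graph s -> 1 < s.
Proof.
move=> n_gt5 [t [G [f [[_ coG fh fs] _ loc]]]]; rewrite ltnNge; apply/negP => s_le1.
have f_inj : injective f.
  move=> x y fxy; have /card_le1_eqP := leq_trans (loc (f y)) s_le1.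
  by apply; rewrite inE ?fxy.
have uG : union_cointerval_graph R (dunion G).
  by exists t, G; split=> //; exists id => //; exists id.
have liftsP (a b c : 'I_n) : a < b -> b < c -> lifts f a b c.
  move=> ab bc; apply: fs.
  by rewrite /= /shift_adj /shift /= ab bc eqxx.
have o j : j < 6 -> {i : 'I_n | i = j :> nat}.
  by move=> lt_j; exists (Ordinal (leq_trans lt_j n_gt5)).
have [a1 e1] := o 0 erefl; have [a2 e2] := o 1 erefl; have [a3 e3] := o 2 erefl.
have [a4 e4] := o 3 erefl; have [a5 e5] := o 4 erefl; have [a6 e6] := o 5 erefl.
apply: (@no_lifted_path _ f a1 a2 a3 a4 a5 a6) => //; try apply: liftsP;
  by rewrite ?e1 ?e2 ?e3 ?e4 ?e5 ?e6.
Qed.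

Section Biclique.
Variable j : 'I_n.

(** Only pairs through [j] are kept, because isolated vertices of a part also count towards
    locality. *)
Definition biclique_vertex : finType := {u : 'I_n * 'I_n | (u.1 == j) || (u.2 == j)}.

Definition biclique_in : pred biclique_vertex :=
  fun u => ((val u).1 < (val u).2) && ((val u).2 == j).

Definition biclique_out : pred biclique_vertex :=
  fun u => ((val u).1 < (val u).2) && ((val u).1 == j).

Definition biclique_adj : rel biclique_vertex :=
  fun u v => biclique_in u && biclique_out v || biclique_in v && biclique_out u.

Lemma biclique_adj_sym : symmetric biclique_adj.
Proof. by move=> u v; rewrite /biclique_adj orbC. Qed.

Lemma biclique_adj_irr : irreflexive biclique_adj.
Proof.
move=> u; rewrite /biclique_adj orbb /biclique_in /biclique_out.
by apply/andP => -[/andP[lt_u /eqP E2] /andP[_ /eqP E1]]; rewrite E1 E2 ltnn in lt_u.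
Qed.

Definition biclique : sgraph := SGraph biclique_adj_sym biclique_adj_irr.

End Biclique.

Lemma shift_graph_local_cover2 : 0 < n ->
  has_local_cover (cointerval_graph R) shift_graph 2.
Proof.
move=> n_gt0; pose f (u : dunion biclique) : shift_graph := val (tagged u).
have biclique_shift j (u v : biclique j) :
    biclique_in u && biclique_out v -> shift (val u) (val v).
  rewrite /biclique_in /biclique_out /shift.
  by move=> /andP[/andP[-> /eqP->] /andP[-> /eqP->]]; rewrite eqxx.
have edge_in a b c : shift (a, b) (b, c) ->
    exists x y : dunion biclique, [/\ adj x y, f x = (a, b) & f y = (b, c)].
  rewrite /shift /= eqxx /= => /andP[ab bc].
  have hx : ((a, b).1 == b) || ((a, b).2 == b) by rewrite eqxx orbT.
  have hy : ((b, c).1 == b) || ((b, c).2 == b) by rewrite eqxx.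
  exists (in_part biclique (Sub (a, b) hx : biclique b)).
  exists (in_part biclique (Sub (b, c) hy : biclique b)).
  rewrite /= /dunion_adj /= eqxx tagged_asE /= /biclique_adj /biclique_in /biclique_out /=.
  by rewrite ab bc eqxx.
exists n, biclique, f; split; [split=> // |..].
- by move=> j; apply: (@biclique_cointerval R (biclique j) (@biclique_in j) (@biclique_out j)).
- move=> x y /dunion_adjP[j [u [v [uv -> ->]]]] /=; rewrite /shift_adj.
  by case/orP: uv => /biclique_shift ->; rewrite ?orbT.
- move=> [a b] [c d] /orP[] h; have /and3P[_ /eqP/= E _] := h.
    by subst c; apply: edge_in.
  subst d; have [x [y [xy fx fy]]] := edge_in _ _ _ h.
  by exists y, x; split=> //; apply: etrans xy; apply: (@adj_sym (dunion biclique)).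
- by move=> j u v; apply: val_inj.
(* A preimage of [v] is determined by its biclique, whose index is one of the two entries of [v]. *)
- move=> v; have tag_inj : {in [pred x : dunion biclique | f x == v] &, injective tag}.
    move=> [i x] [j y]; rewrite !inE /f /= => /eqP <- /eqP E Eij; subst j.
    by congr existT; apply: val_inj.
  rewrite -(card_in_imset tag_inj).
  apply: leq_trans (_ : #|[set v.1; v.2]| <= 2); last by rewrite cards2; case: eqP.
  apply/subset_leq_card/fintype.subsetP => _ /imsetP[[i x] /eqP <- ->].
  by rewrite !inE /f /= ![i == _]eq_sym; apply: (valP x).
Qed.

End ShiftGraph.

(** * Union boxicity and boxicity of the complement of a matching *)

Section Matching.
Variable R : realType.

Lemma edge_adj_sym : symmetric (fun a b : bool => a != b).
Proof. by case; case. Qed.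

Lemma edge_adj_irr : irreflexive (fun a b : bool => a != b).
Proof. by case. Qed.

Definition edge_graph : sgraph := SGraph edge_adj_sym edge_adj_irr.

Lemma edge_graph_cointerval : cointerval_graph R edge_graph.
Proof. by apply: (@biclique_cointerval R edge_graph id negb); case; case. Qed.

Variable k : nat.

Definition matching : sgraph := dunion (fun _ : 'I_k => edge_graph).

Lemma matching_union_cointerval : union_cointerval_graph R matching.
Proof.
exists k, (fun=> edge_graph); split=> [i|]; first exact: edge_graph_cointerval.
by exists id => //; exists id.
Qed.

Lemma matching_union_cover1 :
  has_global_cover (union_cointerval_graph R) matching 1.
Proof.
exists (fun=> matching), (fun u => tagged u); split; first split=> //.
- by move=> i; apply: matching_union_cointerval.
- by move=> x y /dunion_adjP[i [u [v [uv -> ->]]]].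
- move=> u v uv; pose G (_ : 'I_1) := matching.
  exists (in_part G (u : G ord0)), (in_part G (v : G ord0)).
  by rewrite dunion_adj_Tagged.
- by move=> i x y.
Qed.

Lemma matching_cover : 0 < k -> has_global_cover (cointerval_graph R) matching k.
Proof.
move=> k_gt0; exists (fun=> edge_graph), id; split; first split=> //.
- by move=> i; apply: edge_graph_cointerval.
- by move=> u v uv; exists u, v.
- by move=> i x y /eqP; rewrite eq_Tagged /= => /eqP.
Qed.

Lemma matching_cover_ge (t : nat) :
  has_global_cover (cointerval_graph R) matching t -> k <= t.
Proof.
move=> [G [f [[_ coG fh fs] _]]].
pose e (i : 'I_k) (b : bool) : matching :=
  existT (fun _ : 'I_k => vertex edge_graph) i b.
have ex_part (i : 'I_k) : exists j : 'I_t, exists x y : G j,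
    [/\ adj x y, f (in_part G x) = e i true & f (in_part G y) = e i false].
  have [|x' [y' [xy' fx fy]]] := fs (e i true) (e i false).
    by rewrite /= /dunion_adj /= eqxx tagged_asE.
  have [j [x [y [xy ex ey]]]] := dunion_adjP xy'.
  by exists j, x, y; rewrite -ex -ey.
have [part partP] := choice ex_part.
have e_tag i i' b b' : adj (e i b) (e i' b') -> i = i'.
  by case/andP => /= /eqP.
(* If two matching edges chose the same part, a chord between them there would map to an edge of the
   matching, forcing equal indices. *)
suff part_inj : injective part by have := leq_card part part_inj; rewrite !card_ord.
move=> i i' Epart; have [x [y [xy fx fy]]] := partP i.
have := partP i'; rewrite -Epart => -[x2 [y2 [xy2 fx2 fy2]]].
have := cointerval_2K2_free (coG _) xy xy2.
case/or4P; rewrite -dunion_adj_Tagged => /fh; rewrite ?fx ?fy ?fx2 ?fy2; exact: e_tag.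
Qed.

End Matching.

Theorem theorem4 (R : realType) (k : nat) (hk : 0 < k) :
  exists H H' H'' : sgraph,
    [/\ k <= box_local R H,
        box_local R H' = 2 /\ k <= box_union R H'
      & box_union R H'' = 1 /\ box R H'' = k].
Proof.
(* The factor 8 is the one in [incidence_local_cover]. *)
have [p lt_p p_pr] := prime_above (k * 8).
(* The summand 6 provides the six points for local boxicity at least 2; the power excludes union
   covers with fewer than [k] parts. *)
pose n := 6 + 2 ^ (2 ^ (4 * k)).
exists (compl (incidence_graph p)), (compl (shift_graph n)), (compl (matching k)).
rewrite /box_local /box_union /box !complK; split; [|split|split].
- apply: minimum_ge; first exact: has_local_cover_ex.
  move=> s /(incidence_local_cover p_pr) le_p.
  by rewrite -(@leq_pmul2r 8) //; apply: leq_trans (ltnW lt_p) le_p.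
- apply: minimum_eq; first exact: shift_graph_local_cover2.
  by move=> s; apply: shift_graph_local_cover_ge2.
- apply: minimum_ge; first exact: (has_global_cover_ex R _).2.
  move=> t; apply: contraPleq => lt_tk; apply: shift_graph_union_cover.
  apply: leq_ltn_trans (_ : 2 ^ (2 ^ (4 * k)) < _); last by rewrite /n; lia.
  by rewrite !leq_exp2l // leq_mul2l ltnW.
- apply: minimum_eq; first exact: matching_union_cover1.
  (* The bound [0 < t] is part of the definition of a cover. *)
  by move=> t [G [f [[]]]].
- by apply: minimum_eq; [apply: matching_cover|apply: matching_cover_ge].
Qed.
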